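(* Let $X$ be a Banach space and let $M$ be a non-empty, bounded, closed and convex subset of $X$. Let $F:M\to M$ be a mapping (not necessarily continuous) such that $F\,M$ is a relatively compact subset of $X$ and $$\{x\}\cap\mathbb{F}x\subset\{Fx\}\quad\text{for every }x\in M\cap\mathbb{F}\,M,$$ where $\mathbb{F}x=\bigcap_{\varepsilon>0}\overline{\mathrm{co}}\,F(\overline{B}_\varepsilon(x)\cap M)$. Then $F$ has a fixed point in $M$.
   Context: $\overline{B}_\varepsilon(x)$ is the closed ball of center $x$ and radius $\varepsilon$, $\overline{\mathrm{co}}$ denotes the closed convex hull, and $\mathbb{F}\,M=\bigcup_{x\in M}\mathbb{F}x$. *)

(* Defs.v *)
From HB Require Import structures.
From mathcomp Require Import all_boot all_order all_algebra.
From mathcomp Require Import all_classical all_reals all_analysis.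
Set Implicit Arguments.
Unset Strict Implicit.
Unset Printing Implicit Defensive.
Import Order.TTheory GRing.Theory Num.Theory.
Import numFieldNormedType.Exports.
Local Open Scope classical_set_scope.
Local Open Scope ring_scope.

Definition closed_convex_hull (R : realType) (X : normedModType R)
    (A : set X) : set X :=
  smallest [set C : set X | closed C /\ convex_set C] A.

(* A map M -> M is a total map X -> X preserving M; since every ball is
   intersected with M, its values outside M play no role. *)
Definition closed_convex_envelope (R : realType) (X : normedModType R)
    (M : set X) (F : X -> X) (x : X) : set X :=
  \bigcap_(e in [set e : R | 0 < e])
    closed_convex_hull (F @` (closed_ball x e `&` M)).

Definition closed_convex_envelope_image (R : realType) (X : normedModType R)
    (M : set X) (F : X -> X) : set X :=
  \bigcup_(x in M) closed_convex_envelope M F x.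

(* Main.v *)
Require Import Defs.
From HB Require Import structures.
From mathcomp Require Import all_boot all_order all_algebra.
From mathcomp Require Import lra.
From mathcomp Require Import all_classical all_reals all_analysis.
Import Order.TTheory GRing.Theory Num.Theory.
Import numFieldNormedType.Exports.

(** Write [E x] for the envelope of [F] at [x]. It suffices to find a point [x]
    of [M] with [x] in [E x] ([envelope_fixed_point]): such an [x] lies in
    [M] and in the image of the envelope, so the hypothesis on the envelope
    forces [F x = x].

    For each [e > 0] there is a point that belongs to the closed convex hull of
    the values of [F] on the ball of radius [e] around that very point
    ([approximate_fixed_point]). The convex hull of [F @` M] is totally bounded
    ([convex_hull_totally_bounded]) and contains these points, so by
    completeness they have a cluster point as [e] tends to [0], and a cluster
    point lies in its own envelope.

    Approximate fixed points come from a covering theorem for the standard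
    simplex ([closed_cover_simplex]): if closed sets [K i], one for each vertex,
    cover the simplex, then some [a] in it belongs to [K i] for every [i] with
    [0 < a i]. Given a finite [e]-net [z] of the convex hull of [F @` M], take
    for [K i] the weights [a] whose combination of the points [F (z i)] is
    within [e] of [z i]. The resulting combination uses only values of [F]
    within [e] of itself.

    The covering theorem replaces Brouwer's theorem. It follows by compactness
    from a lemma of Scarf on finite sets with several linear orders
    ([dominated_colourful_set]), applied to the points of a fine net of the
    simplex ordered by their coordinates. Scarf's lemma is a parity argument in
    the style of Sperner's, with no triangulation: the role of adjacent cells
    is played by the two ways of completing a set that has one element too few
    ([card_dominated_extensions]). *)

(** * Scarf's combinatorial lemma *)

(** The ranks [r i] are linear orders of [V], one for each colour [i]; [D] is
    dominated when no [t] lies strictly above some element of [D] in every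
    order, that is, when no [t] exceeds the minimum of [D] in all orders at
    once. *)
Definition dominated {C V : finType} (r : C -> V -> nat) (D : {set V}) :=
  [forall t, [exists i, [forall d in D, r i t <= r i d]]].

Lemma dominatedP {C V : finType} {r : C -> V -> nat} {D : {set V}} :
  reflect (forall t, exists i, forall d, d \in D -> r i t <= r i d)
          (dominated r D).
Proof.
apply: (iffP forallP) => H t; first by
  have /existsP[i /forall_inP Hi] := H t; exists i.
by apply/existsP; have [i Hi] := H t; exists i; apply/forall_inP.
Qed.

Lemma sub_dominated (C V : finType) (r : C -> V -> nat) (D E : {set V}) :
  D \subset E -> dominated r E -> dominated r D.
Proof.
move=> /fintype.subsetP DE /dominatedP domE; apply/dominatedP => t.
by have [i Hi] := domE t; exists i => d /DE /Hi.
Qed.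

(** The pivoting step of Scarf's algorithm. Every element of a dominated [D] is
    the minimum of [D] for some order; as there is one more order than there
    are elements, exactly one element is the minimum for two orders [i1] and
    [i2], all the others for a single one. A new element [x] must be the
    minimum of [x |: D] for some order [k], and taking that order away must
    leave every element of [D] a minimum, so [k] is [i1] or [i2]. For either
    choice [x] is forced: it is the highest element for [k] among those that
    exceed the minimum of [D] in all the other orders. *)
Lemma card_dominated_extensions (C V : finType) (r : C -> V -> nat)
    (D : {set V}) :
  (forall i, injective (r i)) -> D != finset.set0 -> #|D|.+1 = #|C| ->
  dominated r D ->
  (forall i, exists t, forall j, j != i ->
    exists2 d, d \in D & r j d < r j t) ->
  #|[set x | (x \notin D) && dominated r (x |: D)]| = 2.
Proof.
move=> r_inj /set0Pn[d0 Dd0] cardD domD pushes.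
pose m i := [arg min_(d < d0 in D) r i d].
have [mD m_min] : (forall i, m i \in D) /\
    (forall i d, d \in D -> r i (m i) <= r i d).
  by split=> i; rewrite /m; case: arg_minnP.
have m_surj d : d \in D -> exists i, m i = d.
  move=> Dd; have /dominatedP/(_ d)[i di] := domD; exists i.
  by apply: (r_inj i); apply/eqP; rewrite eqn_leq m_min // di.
have mC : m @: finset.setT = D.
  apply/finset.setP=> d; apply/imsetP/idP => [[i _ ->] //|/m_surj[i <-]].
  by exists i.
have /injectivePn[i1 [i2 i12 m12]] : ~~ injectiveb m.
  apply/negP => /injectiveP m_inj.
  by have := card_imset finset.setT m_inj; rewrite mC cardsT -cardD => /n_Sn.
have inj_off k : m @: (~: [set k]) = D -> {in ~: [set k] &, injective m}.
  by move=> mk; apply/imset_injP; rewrite mk cardsC1 -cardD.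
have off_surj k l : k != l -> m k = m l -> m @: (~: [set k]) = D.
  move=> kl ml; rewrite -mC; apply/finset.setP => d.
  apply/imsetP/imsetP => -[i _ ->]; first by exists i.
  have [->|ik] := eqVneq i k; last by exists i; rewrite ?inE.
  by exists l; rewrite // !inE eq_sym.
pose T i := [set t | [forall j, (j != i) ==> (r j (m j) < r j t)]].
have TP i t : reflect (forall j, j != i -> r j (m j) < r j t) (t \in T i).
  rewrite inE; apply: (iffP forallP) => H j; last by apply/implyP/H.
  by apply/implyP/H.
have /fin_all_exists[t0 Tt0] : forall i, exists t, t \in T i.
  move=> i; have [t Ht] := pushes i; exists t; apply/TP => j /Ht[d Dd].
  exact/leq_ltn_trans/m_min.
pose x i := [arg max_(t > t0 i in T i) r i t].
have [Tx x_max] : (forall i, x i \in T i) /\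
    (forall i t, t \in T i -> r i t <= r i (x i)).
  by split=> i; rewrite /x; case: arg_maxnP.
have T_below i t : t \in T i -> r i t <= r i (m i).
  move=> /TP Tt; have /dominatedP/(_ t)[j tj] := domD.
  have [<-|/Tt] := eqVneq j i; first exact: tj.
  by rewrite ltnNge tj.
have x_ext k l : k != l -> m k = m l ->
    (x k \notin D) && dominated r (x k |: D).
  move=> kl ml; have mk := off_surj _ _ kl ml; apply/andP; split.
    apply/negP; rewrite -{1}mk => /imsetP[i]; rewrite !inE => ik xE.
    by have /TP/(_ i ik) := Tx k; rewrite xE ltnn.
  apply/dominatedP => t; have [Tt|] := boolP (t \in T k).
    exists k => d; rewrite !inE => /predU1P[->|Dd]; first exact: x_max.
    exact: leq_trans (T_below _ _ Tt) (m_min _ _ Dd).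
  rewrite inE negb_forall => /existsP[j].
  rewrite negb_imply -leqNgt => /andP[jk tj].
  exists j => d; rewrite !inE => /predU1P[->|Dd].
    by apply: leq_trans tj (ltnW _); have /TP := Tx k; apply.
  exact: leq_trans tj (m_min _ _ Dd).
have x12 : x i1 != x i2.
  apply/eqP => xE; have /TP/(_ i2) := Tx i1; rewrite eq_sym i12 => /(_ isT).
  by rewrite ltnNge xE T_below.
rewrite -[RHS](_ : #|[set x i1; x i2]| = 2); last by rewrite cards2 x12.
apply: eq_card => y; rewrite !inE; apply/idP/pred2P; last first.
  case=> ->; first exact: x_ext i12 m12.
  by apply: (x_ext i2 i1); rewrite // eq_sym.
move=> /andP[Dy domDy].
(* Every element of y |: D is now the minimum of that set for some order, and
   y takes the order k away from D. *)
have /dominatedP own := domDy.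
have [k y_min] := own y.
have below_y i d : d \in D -> r i d <= r i y -> r i d < r i y.
  move=> Dd; rewrite leq_eqVlt => /predU1P[/r_inj dy|//].
  by rewrite -dy Dd in Dy.
have ownD d : d \in D -> exists i, [/\ i != k, m i = d & r i d < r i y].
  move=> Dd; have [i d_min] := own d; exists i.
  have dy : r i d < r i y by apply: below_y; rewrite ?d_min ?finset.setU11.
  split=> //.
    by apply: contraTneq dy => ->; rewrite -leqNgt y_min ?finset.setU1r.
  apply: (r_inj i); apply/eqP.
  by rewrite eqn_leq m_min // d_min ?finset.setU1r.
have mk : m @: (~: [set k]) = D.
  apply/finset.setP => d; apply/imsetP/idP => [[i _ ->] //|/ownD[i [ik <- _]]].
  by exists i; rewrite ?inE.
have m_inj := inj_off k mk.
have Ty : y \in T k.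
  apply/TP => j jk; have [i [ik mij]] := ownD (m j) (mD j).
  by rewrite (m_inj i j) ?inE.
have yE : y = x k.
  apply: (r_inj k); apply/eqP; rewrite eqn_leq x_max //=.
  have [i xi] := own (x k).
  have ik : i = k.
    apply: contraTeq (xi (m i) (finset.setU1r _ (mD i))) => ik; rewrite -ltnNge.
    by have /TP := Tx k; apply.
  by have := xi y (finset.setU11 _ _); rewrite ik.
have [k1|k1] := eqVneq k i1; first by left; rewrite yE k1.
have [k2|k2] := eqVneq k i2; first by right; rewrite yE k2.
case/negP: i12; apply/eqP/m_inj => //.
  by rewrite !inE eq_sym.
by rewrite !inE eq_sym.
Qed.

(** If such a facet exists, the colours of [B] are all but [i0], with one of
    them used by exactly two elements: these are the only ones that can be
    removed without losing a colour. *)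
Lemma card_colour_facets (C V : finType) (c : V -> C) (i0 : C) (B : {set V}) :
  #|B| = #|C| -> c @: B != finset.setT ->
  ~~ odd #|[set x in B | c @: (B :\ x) == [set~ i0]]|.
Proof.
move=> cardB not_full.
have [->|/set0Pn[x0]] :=
  eqVneq [set x in B | c @: (B :\ x) == [set~ i0]] finset.set0.
  by rewrite cards0.
rewrite inE => /andP[Bx0 /eqP cx0].
have c_inj y : y \in B -> c @: (B :\ y) = [set~ i0] ->
    {in B :\ y &, injective c}.
  move=> By cy; apply/imset_injP; rewrite cy cardsC1.
  by have := cardsD1 y B; rewrite By cardB => ->; rewrite add1n.
have cBx y : y \in B -> c @: B = c y |: c @: (B :\ y).
  by move=> By; rewrite -imsetU1 finset.setD1K.
have ci0 : c x0 != i0.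
  apply: contraNneq not_full => ci0; rewrite (cBx x0) // cx0 ci0.
  by apply/eqP/finset.setP => i; rewrite !inE orbN.
have /imsetP[x1 x1B c01] : c x0 \in c @: (B :\ x0) by rewrite cx0 !inE.
have /finset.setD1P[x10 Bx1] := x1B.
have cB : c @: B = [set~ i0].
  rewrite (cBx x0) // cx0; apply/finset.setUidPr; rewrite finset.sub1set !inE.
  exact: ci0.
have cx1 : c @: (B :\ x1) = [set~ i0].
  apply/eqP; rewrite finset.eqEsubset -{1}cB imsetS ?finset.subsetDl //=.
  apply/fintype.subsetP => i; rewrite -cB => /imsetP[x Bx ->].
  have [->|xx1] := eqVneq x x1.
    by rewrite -c01; apply/imset_f; rewrite !inE eq_sym x10.
  by apply: imset_f; rewrite !inE xx1.
suff -> : [set x in B | c @: (B :\ x) == [set~ i0]] = [set x0; x1].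
  by rewrite cards2 eq_sym x10.
apply/finset.setP => x; rewrite !inE.
apply/andP/pred2P => [[Bx /eqP cx]|[]->]; last 2 first.
- by rewrite Bx0 cx0.
- by rewrite Bx1 cx1.
have [->|xx0] := eqVneq x x0; first by left.
have [->|xx1] := eqVneq x x1; first by right.
have := c_inj x Bx cx x0 x1; rewrite !inE ![_ == x]eq_sym xx0 xx1 Bx0 Bx1.
by move=> /(_ isT isT c01) x01; rewrite x01 eqxx in x10.
Qed.

(** To each colour [j] a slack point [inr j] is adjoined, lowest in its own
    order and above all of [T] in the others. Slack points play the part of the
    faces of a simplex: a set of points together with a set of orders to ignore
    becomes a single set with as many elements as there are colours. *)
Definition slack_rank {C T : finType} (r : C -> T -> nat) (i : C) (v : T + C) :=
  match v with
  | inl t => (r i t).+1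
  | inr j => if j == i then 0 else (\max_t r i t).+2 + enum_rank j
  end.

Definition slack_colour {C T : finType} (c : T -> C) (v : T + C) :=
  match v with inl t => c t | inr j => j end.

Lemma slack_rank_lt (C T : finType) (r : C -> T -> nat) (i j : C) (t : T) :
  j != i -> slack_rank r i (inl t) < slack_rank r i (inr j).
Proof.
move=> /negPf /= ->; apply: leq_trans (leq_addr _ _); rewrite !ltnS.
exact: (@leq_bigmax _ (r i)).
Qed.

Lemma slack_rank_inj (C T : finType) (r : C -> T -> nat) (i : C) :
  injective (r i) -> injective (slack_rank r i).
Proof.
move=> r_inj [s|j] [t|k] //.
- by move=> [/r_inj ->].
- have [->//=|ki] := eqVneq k i; first by rewrite eqxx.
  by have := slack_rank_lt _ _ r i k s ki => /[swap] ->; rewrite ltnn.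
- have [->//=|ji] := eqVneq j i; first by rewrite eqxx.
  by have := slack_rank_lt _ _ r i j t ji => /[swap] ->; rewrite ltnn.
move=> /=; have [->|ji] := eqVneq j i; have [->|ki] := eqVneq k i => //.
by move=> /addnI /val_inj /enum_rank_inj ->.
Qed.

(** The boundary facet, made of all slack points but one. The only order left
    for a new point to be minimal in is [i0], so that point is the maximum of
    [T] for [i0]. *)
Lemma card_slack_facet_extensions (C T : finType) (r : C -> T -> nat)
    (i0 : C) (t0 : T) :
  (forall i, injective (r i)) ->
  let D := [set inr i | i in [set~ i0]] : {set T + C} in
  #|[set x | (x \notin D) && dominated (slack_rank r) (x |: D)]| = 1.
Proof.
move=> r_inj D; pose t1 := [arg max_(t > t0) r i0 t].
have t1_max t : r i0 t <= r i0 t1.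
  by rewrite /t1; case: arg_maxnP => // ? _; exact.
have DP (j : C) : (inr j \in D) = (j != i0).
  by rewrite mem_imset ?inE // => ? ? [].
have DPl (t : T) : (inl t \in D) = false by apply/imsetP => -[].
suff -> : [set x | (x \notin D) && dominated (slack_rank r) (x |: D)]
    = [set inl t1] by rewrite cards1.
apply/finset.setP => x; rewrite !inE.
apply/andP/eqP => [[Dx /dominatedP dom]|->].
  case: x => [t|j] in Dx dom *.
    have [i i_min] := dom (inl t1).
    have [ii0|ii0] := eqVneq i i0.
      congr inl; apply: (r_inj i0); apply/eqP; rewrite eqn_leq t1_max /=.
      by have := i_min (inl t); rewrite ii0 !inE eqxx; apply.
    have := i_min (inr i); rewrite finset.in_setU DP ii0 orbT /= eqxx.
    by move=> /(_ isT).
  have ji0 : j = i0 by move: Dx; rewrite DP negbK => /eqP.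
  have [i i_min] := dom (inl t0).
  have /i_min : inr i \in inr j |: D.
    rewrite finset.in_setU1 DP ji0.
    by have [->|_] := eqVneq i i0; rewrite ?eqxx ?orbT.
  by rewrite /= eqxx.
rewrite DPl; split=> //; apply/dominatedP => -[t|j]; last first.
  by exists j => d _; rewrite /= eqxx.
exists i0 => d; rewrite finset.in_setU1 => /predU1P[->|/imsetP[j]].
  by rewrite ltnS t1_max.
rewrite !inE => ji0 ->; apply: ltnW.
exact: slack_rank_lt.
Qed.

(** Parity argument. Count the pairs of a dominated set [B] with one element
    per colour and an element [x] of [B] such that [B :\ x] has all colours but
    [i0]. If no [B] has all the colours, grouping the pairs by [B] shows their
    number to be even. Grouped by [D := B :\ x], they come in twos, except for
    the single one that the boundary facet contributes: their number is odd. *)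
Lemma full_cell_exists (C T : finType) (r : C -> T -> nat) (c : T -> C)
    (i0 : C) (t0 : T) :
  (forall i, injective (r i)) ->
  exists B : {set T + C},
    dominated (slack_rank r) B /\ slack_colour c @: B = finset.setT.
Proof.
move=> r_inj; pose r' := slack_rank r; pose c' := slack_colour c.
have r'_inj i : injective (r' i) by exact: slack_rank_inj.
pose cell (B : {set T + C}) := dominated r' B && (#|B| == #|C|).
have [/existsP[B /and3P[domB _ /eqP]]|] :=
  boolP [exists B, [&& dominated r' B, #|B| == #|C| & c' @: B == finset.setT]].
  by exists B.
rewrite negb_exists => /forallP no_full.
pose door (D : {set T + C}) := (c' @: D == [set~ i0]).
pose N := \sum_(B : {set T + C}) \sum_x
  ((x \in B) && cell B && door (B :\ x) : nat).
have N_even : ~~ odd N.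
  apply: (big_ind (fun n => ~~ odd n)) => // [p q /negPf|B _].
    by rewrite oddD => -> /negPf ->.
  have [/andP[domB /eqP cardB]|_] := boolP (cell B); last first.
    by rewrite big1 // => x _; rewrite andbF.
  have notfull : c' @: B != finset.setT.
    by have := no_full B; rewrite domB cardB eqxx.
  have := card_colour_facets _ _ c' i0 B cardB notfull.
  rewrite -sum1dep_card big_mkcond /=.
  congr (~~ odd _); apply: eq_bigr => x _.
  by rewrite andbT; case: ifP.
have NE : N = \sum_(D : {set T + C}) \sum_x
    ((x \notin D) && cell (x |: D) && door D : nat).
  rewrite /N exchange_big [RHS]exchange_big /=; apply: eq_bigr => x _.
  rewrite [LHS](bigID (fun B : {set T + C} => x \in B)) /=.
  rewrite [X in _ + X]big1 ?addn0 => [|B /negPf ->//].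
  rewrite [RHS](bigID (fun D : {set T + C} => x \in D)) /=.
  rewrite [X in X + _]big1 ?add0n => [|B ->//].
  rewrite (reindex_onto (fun D => x |: D) (fun B => B :\ x)) /=; last first.
    by move=> B Bx; rewrite finset.setD1K.
  apply: eq_big => [D|D]; rewrite finset.setU11 /=.
    by apply/eqP/idP => [<-|/finset.setU1K//]; rewrite !inE eqxx.
  by move=> /eqP DE; rewrite DE (_ : x \notin D) // -DE !inE eqxx.
pose D0 : {set T + C} := [set inr i | i in [set~ i0]].
have cardC : #|C| = #|[set~ i0]|.+1.
  by rewrite cardsC1 prednK //; apply/card_gt0P; exists i0.
have inr_inj : injective (@inr T C) by move=> ? ? [].
have cardD0 : #|D0|.+1 = #|C| by rewrite card_imset.
have colD0 : door D0.
  by rewrite /door /D0 -imset_comp (eq_imset (g := id)) ?imset_id.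
case/negP: N_even; rewrite NE (bigD1 D0) //= oddD.
have -> : \sum_x ((x \notin D0) && cell (x |: D0) && door D0 : nat) = 1.
  rewrite -[RHS](card_slack_facet_extensions _ _ r i0 t0 r_inj).
  rewrite -sum1dep_card [RHS]big_mkcond /=; apply: eq_bigr => x _.
  rewrite colD0 andbT /cell cardsU1.
  by case: (x \in D0) => //=; rewrite add1n cardD0 eqxx andbT; case: ifP.
rewrite addTb; apply: (big_ind (fun n => ~~ odd n)) => // [p q /negPf|D DD0].
  by rewrite oddD => -> /negPf ->.
have [/eqP cD|_] := boolP (door D); last first.
  by rewrite big1 // => x _; rewrite andbF.
have [cardD|cardD] := eqVneq #|D|.+1 #|C|; last first.
  rewrite big1 // => x _; rewrite /cell cardsU1.
  by case: (x \in D); rewrite //= add1n (negPf cardD) andbF.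
have -> : \sum_x ((x \notin D) && cell (x |: D) && true : nat)
    = #|[set x | (x \notin D) && dominated r' (x |: D)]|.
  rewrite -sum1dep_card [RHS]big_mkcond /=; apply: eq_bigr => x _.
  rewrite andbT /cell cardsU1.
  by case: (x \in D) => //=; rewrite add1n cardD eqxx andbT; case: ifP.
(* Two extensions need a point of T in D: each slack point inr i then lies
   above the minimum of D in every order but i, so that none of the sets of
   candidates in the pivoting step is empty. *)
have [t Dt] : exists t, inl t \in D.
  apply/existsP; apply: contraNT DD0; rewrite negb_exists => /forallP noT.
  rewrite eqEcard -ltnS cardD cardD0 leqnn andbT.
  apply/fintype.subsetP => -[t|j] Dv; first by rewrite (negPf (noT t)) in Dv.
  by rewrite mem_imset // -cD; apply/imsetP; exists (inr j).
have [domD|ndomD] := boolP (dominated r' D); last first.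
  suff -> : [set x | (x \notin D) && dominated r' (x |: D)] = finset.set0.
    by rewrite cards0.
  apply/finset.setP => x; rewrite !inE; apply/negP => /andP[_ domx].
  by case/negP: ndomD; apply: sub_dominated domx; apply: finset.subsetU1.
rewrite card_dominated_extensions //; first by apply/set0Pn; exists (inl t).
move=> i; exists (inr i) => j ji; exists (inl t) => //.
by apply: slack_rank_lt; rewrite eq_sym.
Qed.

(** Scarf's lemma, with the slack points eliminated: an order whose slack point
    belongs to the full cell cannot witness that a point of [T] is dominated, so
    the colour of the witness comes from [A], the part of the cell in [T]. *)
Lemma dominated_colourful_set (C T : finType) (r : C -> T -> nat)
    (c : T -> C) (t0 : T) :
  (forall i, injective (r i)) ->
  exists A : {set T}, forall t, exists2 i,
    i \in c @: A & forall a, a \in A -> r i t <= r i a.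
Proof.
move=> r_inj; have [B [/dominatedP domB fullB]] :=
  full_cell_exists C T r c (c t0) t0 r_inj.
exists [set t | inl t \in B] => t; have [i i_min] := domB (inl t).
exists i => [|a]; last by rewrite inE => /i_min.
have : i \in slack_colour c @: B by rewrite fullB.
case/imsetP => -[a|j] Bv /= iE; first by rewrite iE imset_f ?inE.
by have := i_min _ Bv; rewrite /= -iE eqxx.
Qed.

(** * Convex combinations and total boundedness *)

Local Open Scope classical_set_scope.
Local Open Scope ring_scope.

Lemma convex_setP (R : realType) (X : lmodType R) (A : set X) :
  convex_set A <->
  forall (x y : X) (t : R), 0 <= t <= 1 -> A x -> A y ->
    A (t *: x + (1 - t) *: y).
Proof.
split=> [convA x y t /andP[t0 t1] Ax Ay|convA x y t].
  have := convA x y (Itv01 t0 t1); rewrite !inE; exact.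
by rewrite !inE => Ax Ay; apply: convA => //; rewrite ge0 le1.
Qed.

(** Membership in [A] is asked of the points of positive weight alone, so that
    the support of the weights can select the values of a map on a small
    ball. *)
Lemma convex_set_sum (R : realType) (X : lmodType R) (A : set X) (n : nat)
    (y : 'I_n -> X) (a : 'I_n -> R) :
  convex_set A -> (forall i, 0 <= a i) -> \sum_i a i = 1 ->
  (forall i, 0 < a i -> A (y i)) -> A (\sum_i a i *: y i).
Proof.
move=> /convex_setP convA.
elim: n => [|n IHn] in y a *.
  by move=> _; rewrite big_ord0 => /esym/eqP; rewrite oner_eq0.
move=> a0; rewrite !big_ord_recl /= => a1 Ay.
set s := \sum_(i < n) _ in a1.
have s0 : 0 <= s by apply: sumr_ge0.
have [s_eq0|s_neq0] := eqVneq s 0.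
  have a00 : a ord0 = 1 by rewrite -a1 s_eq0 addr0.
  rewrite big1 => [|i _]; last first.
    have /eqP := s_eq0; rewrite psumr_eq0 // => /allP/(_ i).
    by rewrite mem_index_enum => /(_ isT)/eqP ->; rewrite scale0r.
  by rewrite addr0 a00 scale1r; apply: Ay; rewrite a00.
have s_gt0 : 0 < s by rewrite lt_neqAle eq_sym s_neq0.
have tailA : A (\sum_(i < n) (a (lift ord0 i) / s) *: y (lift ord0 i)).
  apply: IHn => [i||i ai]; first by rewrite divr_ge0.
    by rewrite -mulr_suml divff.
  by apply: Ay; rewrite pmulr_lgt0 ?invr_gt0 in ai.
have sE : s = 1 - a ord0 by rewrite -a1 addrAC subrr add0r.
have -> : \sum_(i < n) a (lift ord0 i) *: y (lift ord0 i)
    = (1 - a ord0) *: \sum_(i < n) (a (lift ord0 i) / s) *: y (lift ord0 i).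
  rewrite -sE scaler_sumr; apply: eq_bigr => i _.
  by rewrite scalerA mulrCA divff // mulr1.
have [a00|a00] := eqVneq (a ord0) 0.
  by rewrite a00 scale0r add0r subr0 scale1r.
apply: convA => //; last by apply: Ay; rewrite lt_neqAle eq_sym a00 a0.
by rewrite a0 -subr_ge0 -sE.
Qed.

(** The centres are in [A] itself: they have to be points where a map defined on
    [A] can be evaluated. *)
Definition totally_bounded {R : realType} {X : normedModType R} (A : set X) :=
  forall e : R, 0 < e -> exists n (z : 'I_n -> X),
    (forall k, A (z k)) /\ (forall x, A x -> exists k, `|x - z k| < e).

Lemma precompact_totally_bounded (R : realType) (X : normedModType R)
    (A : set X) : precompact A -> totally_bounded A.
Proof.
rewrite precompactE compact_cover => cptA e e0.
have [D' D'A cover_A] : finite_subset_cover A (fun y => ball y e) (closure A).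
  apply: cptA => [y _|x clAx]; first exact: ball_open.
  have [y [Ay xy]] := clAx _ (nbhsx_ballx x e e0).
  by exists y => //; apply: ball_sym.
pose s := finmap.enum_fset D'.
exists (size s), (tnth (in_tuple s)); split=> [k|x Ax].
  by have /D'A := mem_tnth k (in_tuple s); rewrite inE.
have [y /= D'y] := cover_A x (subset_closure Ax).
have [k yE] := tnthP (in_tuple s) y D'y.
by rewrite -ball_normE /= distrC => xy; exists k; rewrite -yE.
Qed.

(** An ultrafilter that contains a totally bounded set contains a ball of each
    radius, hence is Cauchy. *)
Lemma complete_cluster_point (R : realType) (X : completeNormedModType R)
    (A : set X) (F : set_system X) (FF : ProperFilter F) :
  totally_bounded A -> F A -> cluster F !=set0.
Proof.
move=> tbA FA; have [G [UG FG]] := ultraFilterLemma FF.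
have PG : ProperFilter G by exact: ultra_proper.
suff : cvg G.
  move=> /cvg_ex[x Gx]; exists x; apply: (cvg_cluster FG).
  by rewrite (ultra_cvg_clusterE UG).
apply: cauchy_cvg; apply: cauchy_exP => e e0.
have [n [z [_ zA]]] := tbA e e0.
apply: contrapT => no_ball.
have Gfar : G [set x | forall k, ~ ball (z k) e x].
  apply: filter_forall => k.
  have [Gb|//] := in_ultra_setVsetC (ball (z k) e) UG.
  by case: no_ball; exists (z k).
have [x [Ax far]] := filter_ex (filterI (FG _ FA) Gfar).
have [k xz] := zA x Ax; apply: (far k).
by rewrite -ball_normE /= distrC.
Qed.

(** * A covering theorem for the simplex *)

(** Ties are broken by the position in a sorted enumeration. *)
Lemma rank_exists (T : finType) (R : realDomainType) (f : T -> R) :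
  exists r : T -> nat,
    injective r /\ forall s t, (r s <= r t)%N -> f s <= f t.
Proof.
pose e := relpre f <=%R; pose l := sort e (enum T).
have lT t : t \in l by rewrite mem_sort mem_enum.
exists (index^~ l); split=> [s t|s t st]; first exact: index_inj.
have e_total : total e by move=> x y; exact: le_total.
apply: (@sorted_leq_index _ e _ _ l) => //.
- by move=> x y z; exact: le_trans.
- by move=> x; exact: lexx.
exact: sort_sorted.
Qed.

Definition simplex (R : realType) (n : nat) : set 'rV[R]_n :=
  [set a | (forall i, 0 <= a ord0 i) /\ \sum_i a ord0 i = 1].

Lemma coord_norm_le (R : realType) (n : nat) (a : 'rV[R]_n) (i : 'I_n) :
  `|a ord0 i| <= `|a|.
Proof.
rewrite [leRHS]/Num.Def.normr /= mx_normrE; apply/bigmax_geP; right => /=.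
by exists (ord0, i).
Qed.

Lemma row_norm_le (R : realType) (n : nat) (a : 'rV[R]_n) (e : R) :
  0 <= e -> (forall i, `|a ord0 i| <= e) -> `|a| <= e.
Proof.
move=> e0 ae; rewrite [leLHS]/Num.Def.normr /= mx_normrE; apply/bigmax_leP.
by split=> // -[j i] _ /=; rewrite ord1.
Qed.

Lemma continuous_row_combination (R : realType) (X : normedModType R) (n : nat)
    (y : 'I_n -> X) :
  continuous (fun a : 'rV[R]_n => \sum_i a ord0 i *: y i).
Proof.
apply: continuous_big => [|i _ a]; first exact: add_continuous.
by apply: cvgZr_tmp; [exact: (nbhs_filter a)|exact: coord_continuous].
Qed.

Lemma simplex_coord_le1 (R : realType) (n : nat) (a : 'rV[R]_n) (i : 'I_n) :
  simplex R n a -> a ord0 i <= 1.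
Proof.
by move=> [a0 <-]; rewrite (bigD1 i) //= lerDl sumr_ge0.
Qed.

Lemma compact_simplex (R : realType) (n : nat) : compact (simplex R n).
Proof.
apply: bounded_closed_compact.
  exists 1; split=> // M M1 a Sa; apply: row_norm_le => [|i].
    exact/ltW/(lt_trans ltr01).
  rewrite ger0_norm; last by case: Sa.
  exact/ltW/(le_lt_trans (simplex_coord_le1 _ _ _ _ Sa)).
have -> : simplex R n =
    (\bigcap_(i in [set: 'I_n])
      (fun a : 'rV[R]_n => a ord0 i) @^-1` [set x | 0 <= x])
    `&` (fun a : 'rV[R]_n => \sum_i a ord0 i *: (1 : R^o)) @^-1`
      [set x | x = 1].
  rewrite eqEsubset; split=> a [a0 a1]; split.
  - by move=> i _; exact: a0.
  - by rewrite /= -[RHS]a1; apply: eq_bigr => i _; rewrite [LHS]mulr1.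
  - by move=> i; exact: a0.
  by rewrite -[RHS]a1; apply: eq_bigr => i _; rewrite [RHS]mulr1.
apply: closedI.
  apply: closed_bigI => i _; apply: preimage_closed (@closed_ge _ _) => a _.
  exact: coord_continuous.
apply: preimage_closed (@closed_eq _ _) => a _.
exact: continuous_row_combination.
Qed.

Lemma precompact_simplex (R : realType) (n : nat) : precompact (simplex R n).
Proof.
by apply: compact_precompact; [exact: norm_hausdorff|exact: compact_simplex].
Qed.

(** Apply Scarf's lemma to the points of a fine net of the simplex, ordered by
    each coordinate and coloured by a member of the cover that contains them.
    Let [A] be the resulting set and [m i] the least [i]-th coordinate on [A],
    or [0] when no point of [A] has colour [i]. If the [m i] added up to at most
    [1 - k], the gap shared equally among the coordinates would give a point of
    the simplex, and then a point of the net, above [m] in every coordinate,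
    against domination. So all the points of [A] are within [k] of each other
    and have coordinates at most [k] at the colours that [A] misses. *)
Lemma approximate_cover_point (R : realType) (n : nat)
    (K : 'I_n -> set 'rV[R]_n) (k : R) :
  (0 < n)%N -> 0 < k ->
  (forall a, simplex R n a -> exists i, K i a) ->
  exists2 a, simplex R n a &
    forall i, a ord0 i <= k \/ exists2 b, K i b & `|b - a| <= k.
Proof.
move=> n_gt0 k0 cover.
have nR_gt0 : 0 < n%:R :> R by rewrite ltr0n.
have [N [v [Sv vnet]]] := precompact_totally_bounded _ _ _
  (precompact_simplex R n) (k / n%:R) (divr_gt0 k0 nR_gt0).
(* The barycentre shows that the net is not empty. *)
have [t0 _] : exists t : 'I_N, True.
  pose a : 'rV[R]_n := \row_i n%:R^-1.
  have [|t _] := vnet a; last by exists t.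
  split=> [i|]; first by rewrite mxE invr_ge0 ltW.
  rewrite (eq_bigr (fun=> n%:R^-1)) => [|i _]; last by rewrite mxE.
  by rewrite sumr_const card_ord -[LHS]mulr_natr mulVf // gt_eqF.
have [c cK] := fin_all_exists (fun t => cover (v t) (Sv t)).
have [r r_prop] := fin_all_exists
  (fun i => rank_exists 'I_N R (fun t => v t ord0 i)).
have [A domA] := dominated_colourful_set _ _ r c t0 (fun i => (r_prop i).1).
have [i0 /imsetP[a0 Aa0 _] _] := domA t0.
pose S := (c @: A)%SET.
pose m i := if i \in S then v [arg min_(t < a0 in A) r i t] ord0 i else 0.
have m_le a i : a \in A -> m i <= v a ord0 i.
  move=> Aa; rewrite /m; case: ifP => _; last by case: (Sv a).
  case: arg_minnP => // t _ /(_ a Aa); exact: (r_prop i).2.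
have m_ge0 i : 0 <= m i.
  by rewrite /m; case: ifP => // _; case: (Sv [arg min_(t < a0 in A) r i t]).
have m_sum : 1 - \sum_i m i < k.
  rewrite ltNge; apply/negP => gap.
  have gap0 := lt_le_trans k0 gap.
  pose b : 'rV[R]_n := \row_i (m i + (1 - \sum_i m i) / n%:R).
  have [|t bt] := vnet b.
    split=> [i|]; first by rewrite mxE addr_ge0 // divr_ge0 // ltW.
    rewrite (eq_bigr (fun i => m i + (1 - \sum_i m i) / n%:R)); last first.
      by move=> i _; rewrite mxE.
    rewrite big_split /= sumr_const card_ord -[X in _ + X]mulr_natr.
    rewrite divfK ?gt_eqF //.
    by rewrite addrC subrK.
  have [i Si t_le] := domA t.
  have : m i < v t ord0 i.
    have := le_lt_trans (coord_norm_le _ _ _ i) bt; rewrite !mxE ltr_norml.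
    move=> /andP[_]; rewrite ltrBlDr => /(le_lt_trans _) lt_v.
    rewrite -(ltrD2r (k / n%:R)) addrC [ltRHS]addrC addrC; apply: lt_v.
    by rewrite lerD2l ler_pM2r ?invr_gt0.
  rewrite ltNge /m Si; case: arg_minnP => // s As _.
  by rewrite ((r_prop i).2 _ _ (t_le s As)).
have close a i : a \in A -> v a ord0 i - m i < k.
  move=> Aa; apply: le_lt_trans m_sum.
  have [_ <-] := Sv a; rewrite -sumrB (bigD1 i) //= lerDl.
  by apply: sumr_ge0 => j _; rewrite subr_ge0 m_le.
exists (v a0) => // i; have [/imsetP[b Ab iE]|notS] := boolP (i \in S).
  right; exists (v b); first by rewrite iE.
  apply: row_norm_le => [|j]; first exact: ltW.
  rewrite !mxE ler_norml.
  have := close a0 j Aa0; have := close b j Ab.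
  have := m_le a0 j Aa0; have := m_le b j Ab; lra.
by left; have := close a0 i Aa0; rewrite /m (negPf notS) subr0 => /ltW.
Qed.

(** A dual form of the Knaster-Kuratowski-Mazurkiewicz lemma, equivalent to
    Brouwer's theorem: cluster points of the approximate solutions are exact
    ones because the [K i] are closed. *)
Lemma closed_cover_simplex (R : realType) (n : nat)
    (K : 'I_n -> set 'rV[R]_n) :
  (0 < n)%N -> (forall i, closed (K i)) ->
  (forall a, simplex R n a -> exists i, K i a) ->
  exists2 a, simplex R n a & forall i, 0 < a ord0 i -> K i a.
Proof.
move=> n_gt0 closedK cover.
have approx (p : nat) : exists a, simplex R n a /\ forall i,
    a ord0 i <= p.+1%:R^-1 \/ exists2 b, K i b & `|b - a| <= p.+1%:R^-1.
  have [||a] := approximate_cover_point R n K p.+1%:R^-1 n_gt0.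
  - by rewrite invr_gt0 ltr0n.
  - exact: cover.
  by exists a.
have [u u_prop] := choice approx.
have [a [Sa a_cluster]] : simplex R n `&` cluster (u @ \oo) !=set0.
  by apply: compact_simplex; exists 0%N => // p _; case: (u_prop p).
exists a => // i ai; apply: closedK => B /nbhs_ballP[e /= e0 eB].
have [d d0 [d_e d_a]] : exists2 d : R, 0 < d & d <= e / 2 /\ d <= a ord0 i / 2.
  exists (Num.min (e / 2) (a ord0 i / 2)); first by rewrite lt_min !divr_gt0.
  by rewrite !ge_min !lexx orbT.
have [_ [[p pd <-] /= up]] :
    (u @` [set p | p.+1%:R^-1 < d]) `&` ball a d !=set0.
  apply: a_cluster; last exact: nbhsx_ballx.
  apply: filterS (near_infty_natSinv_lt (PosNum d0)) => p /= pd.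
  by exists p.
rewrite -ball_normE /= in up.
have [small|[b Kb ub]] := (u_prop p).2 i.
  have := le_lt_trans (coord_norm_le _ _ _ i) up; rewrite !mxE ltr_norml.
  move=> /andP[_]; rewrite ltrBlDr => a_up.
  suff : a ord0 i < a ord0 i by rewrite ltxx.
  apply: lt_le_trans a_up _; rewrite [leRHS]splitr lerD //.
  exact: le_trans small (le_trans (ltW pd) d_a).
exists b; split=> //; apply: eB; rewrite -ball_normE /=.
have -> : a - b = (a - u p) - (b - u p) by rewrite opprB addrA subrK.
apply: le_lt_trans (ler_normB _ _) _; rewrite [ltRHS]splitr ltrD //.
  exact: lt_le_trans up d_e.
exact: le_lt_trans ub (lt_le_trans pd d_e).
Qed.

(** * Approximate fixed points and their limits *)

Lemma convex_smallest (R : realType) (X : lmodType R) (A : set X) :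
  convex_set (smallest (@convex_set R X) A).
Proof.
apply/convex_setP => x y t t01 Hx Hy C [convC AC].
by move/convex_setP: (convC); apply => //; [exact: Hx|exact: Hy].
Qed.

Lemma simplex_convex (R : realType) (n : nat) : convex_set (simplex R n).
Proof.
apply/convex_setP => a b t /andP[t0 t1] [a0 a1] [b0 b1]; split=> [i|].
  by rewrite !mxE addr_ge0 // mulr_ge0 // subr_ge0.
rewrite (eq_bigr (fun i => t * a ord0 i + (1 - t) * b ord0 i)); last first.
  by move=> i _; rewrite !mxE.
by rewrite big_split /= -!mulr_sumr a1 b1 !mulr1 addrC subrK.
Qed.

Lemma simplex_vertex (R : realType) (n : nat) (k : 'I_n) :
  simplex R n (delta_mx ord0 k).
Proof.
split=> [i|]; first by rewrite mxE ler0n.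
rewrite (bigD1 k) //= mxE !eqxx big1 ?addr0 // => i ik.
by rewrite mxE (negPf ik) andbF.
Qed.

(** Mazur's theorem. A finite net of [A] spans a polytope, which is compact as a
    continuous image of a simplex; the points at distance at most [e / 2] from
    the polytope form a convex set that contains [A], hence contains the hull.
    The net is kept inside [A] so that the net of the polytope lies in the
    hull. *)
Lemma convex_hull_totally_bounded (R : realType) (X : normedModType R)
    (A : set X) :
  totally_bounded A -> totally_bounded (smallest (@convex_set R X) A).
Proof.
move=> tbA e e0; have e20 : 0 < e / 2 by rewrite divr_gt0.
have [n [y [Ay ynet]]] := tbA (e / 2) e20.
pose p (a : 'rV[R]_n) := \sum_i a ord0 i *: y i.
have tbP : totally_bounded (p @` simplex R n).
  apply: precompact_totally_bounded; apply: compact_precompact.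
    exact: norm_hausdorff.
  apply: continuous_compact; last exact: compact_simplex.
  exact/continuous_subspaceT/continuous_row_combination.
have [m [q [Pq qnet]]] := tbP (e / 2) e20.
exists m, q; split=> [k|x].
  have [a [a0 a1] <-] := Pq k.
  apply: (convex_set_sum R X _ n y (fun i => a ord0 i)) => // [|i _].
    exact: convex_smallest.
  by apply: sub_gen_smallest; exact: Ay.
pose C : set X := [set x | exists2 a, simplex R n a & `|x - p a| <= e / 2].
suff HC : smallest (@convex_set R X) A `<=` C.
  move=> /HC[a Sa xa]; have [|k pk] := qnet (p a); first by exists a.
  exists k; have -> : x - q k = (x - p a) + (p a - q k) by rewrite addrA subrK.
  by rewrite (le_lt_trans (ler_normD _ _)) // [ltRHS]splitr ler_ltD.
apply: smallest_sub => [|{}x Ax]; last first.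
  have [k xk] := ynet x Ax; exists (delta_mx ord0 k).
    exact: simplex_vertex.
  rewrite /p (bigD1 k) //= mxE !eqxx scale1r big1 ?addr0 => [|i ik].
    exact: ltW.
  by rewrite mxE (negPf ik) andbF scale0r.
apply/convex_setP => u v t /[dup] t01 /andP[t0 t1] [a Sa ua] [b Sb vb].
exists (t *: a + (1 - t) *: b).
  by have /convex_setP := simplex_convex R n; apply.
have -> : p (t *: a + (1 - t) *: b) = t *: p a + (1 - t) *: p b.
  rewrite /p !scaler_sumr -big_split /=; apply: eq_bigr => i _.
  by rewrite !mxE [LHS]scalerDl !scalerA.
rewrite opprD addrACA -!scalerBr (le_trans (ler_normD _ _)) // !normrZ.
rewrite (ger0_norm t0) ger0_norm ?subr_ge0 //.
have -> : e / 2 = t * (e / 2) + (1 - t) * (e / 2).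
  by rewrite -mulrDl addrC subrK mul1r.
by rewrite lerD // ler_wpM2l // subr_ge0.
Qed.

(** Let [z] be a finite [e]-net of the convex hull [H] of [F @` M]. Sending the
    weights [a] to the combination [p a] of the values [F (z k)] maps the
    simplex into [H], and the closed balls around the [z k] pull back to a
    closed cover of the simplex. The covering theorem gives [a] such that every
    [z k] of positive weight is within [e] of [p a]. So [p a] is a convex
    combination of values of [F] at points within [e] of [p a] itself. However
    irregular [F] is, [p] is continuous, as it involves only finitely many
    values of [F]. *)
Lemma approximate_fixed_point (R : realType) (X : normedModType R)
    (M : set X) (F : X -> X) (e : R) :
  M !=set0 -> convex_set M -> (forall x, M x -> M (F x)) ->
  precompact (F @` M) -> 0 < e ->
  exists2 x, smallest (@convex_set R X) (F @` M) x &
    closed_convex_hull (F @` (closed_ball x e `&` M)) x.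
Proof.
move=> [x0 Mx0] convM FM pcFM e0; set H := smallest _ _.
have HM : H `<=` M by apply: smallest_sub => // _ [x Mx <-]; exact: FM.
have FH x : M x -> H (F x) by move=> Mx; apply: sub_gen_smallest; exists x.
have tbH : totally_bounded H.
  exact/convex_hull_totally_bounded/precompact_totally_bounded.
have [n [z [Hz znet]]] := tbH e e0.
pose p (a : 'rV[R]_n) := \sum_i a ord0 i *: F (z i).
have n_gt0 : (0 < n)%N.
  have [k _] := znet _ (FH _ Mx0); exact: leq_ltn_trans (leq0n _) (ltn_ord k).
have Hp a : simplex R n a -> H (p a).
  move=> [a0 a1].
  apply: (convex_set_sum R X _ n _ (fun i => a ord0 i)) => // [|i _].
    exact: convex_smallest.
  exact: FH (HM _ (Hz i)).
have [|a Sa|a Sa az] := closed_cover_simplex R n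
  (fun k => p @^-1` closed_ball (z k) e) n_gt0.
- have /continuous_closedP p_closed :=
    continuous_row_combination R X n (F \o z).
  by move=> k; apply: p_closed; exact: closed_ball_closed.
- have [k pk] := znet _ (Hp a Sa); exists k.
  by rewrite /= closed_ballE // /closed_ball_ /= distrC ltW.
exists (p a); first exact: Hp.
move=> C [[closedC convC] FC]; have [a0 a1] := Sa.
apply: (convex_set_sum R X _ n _ (fun i => a ord0 i)) => // i /az.
rewrite /= closed_ballE // /closed_ball_ /= => zi.
apply: FC; exists (z i) => //; split; last exact: HM.
by rewrite closed_ballE // /closed_ball_ /= distrC.
Qed.

(** A cluster point [x] of approximate fixed points [u p] works: near [x], the
    ball around [u p] is contained in the ball of radius [e] around [x], so the
    closed convex hull for [x] and [e] contains [u p] and then its limit. *)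
Lemma envelope_fixed_point (R : realType) (X : completeNormedModType R)
    (M : set X) (F : X -> X) :
  M !=set0 -> closed M -> convex_set M -> (forall x, M x -> M (F x)) ->
  precompact (F @` M) ->
  exists2 x, M x & closed_convex_envelope M F x x.
Proof.
move=> M0 closedM convM FM pcFM; set H := smallest (@convex_set R X) (F @` M).
have HM : H `<=` M by apply: smallest_sub => // _ [x Mx <-]; exact: FM.
have approx (p : nat) : exists x, H x /\
    closed_convex_hull (F @` (closed_ball x p.+1%:R^-1 `&` M)) x.
  have [|x Hx hx] :=
    approximate_fixed_point R X M F p.+1%:R^-1 M0 convM FM pcFM.
    by rewrite invr_gt0 ltr0n.
  by exists x.
have [u u_prop] := choice approx.
have tbH : totally_bounded H.
  exact/convex_hull_totally_bounded/precompact_totally_bounded.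
have [x x_cluster] : cluster (u @ \oo) !=set0.
  apply: (complete_cluster_point R X H _ _ tbH).
  by exists 0%N => // p _; case: (u_prop p).
have near_x (d : R) : 0 < d ->
    exists2 p : nat, p.+1%:R^-1 < d & `|x - u p| < d.
  move=> d0; have [_ [[p pd <-] xp]] :
      (u @` [set p | p.+1%:R^-1 < d]) `&` ball x d !=set0.
    apply: x_cluster; last exact: nbhsx_ballx.
    by apply: filterS (near_infty_natSinv_lt (PosNum d0)) => p pd; exists p.
  by exists p => //; rewrite -ball_normE in xp.
exists x.
  apply: closedM => B /nbhs_ballP[d /= d0 dB]; have [p _ xp] := near_x d d0.
  exists (u p); split; first by apply: HM; case: (u_prop p).
  by apply: dB; rewrite -ball_normE.
move=> e /= e0 C [[closedC convC] FC].
apply: (closedC) => B /nbhs_ballP[d /= d0 dB].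
have [|p p_d xp] := near_x (Num.min d (e / 2)).
  by rewrite lt_min d0 divr_gt0.
move: p_d xp; rewrite !lt_min => /andP[_ p_e] /andP[xp_d xp_e].
exists (u p); split; last by apply: dB; rewrite -ball_normE.
apply: (u_prop p).2; split=> // _ [y [uy My] <-].
apply: FC; exists y => //; split=> //.
move: uy; rewrite !closed_ballE ?invr_gt0 ?ltr0n // /closed_ball_ /= => uy.
have -> : x - y = (x - u p) + (u p - y) by rewrite addrA subrK.
rewrite (le_trans (ler_normD _ _)) // [leRHS]splitr lerD ?(ltW xp_e) //.
exact: le_trans uy (ltW p_e).
Qed.

Theorem theorem4p3 (R : realType) (X : completeNormedModType R)
    (M : set X) (F : X -> X)
    (M_nonempty : M !=set0) (M_bounded : bounded_set M)
    (M_closed : closed M) (M_convex : convex_set M)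
    (F_maps : forall x, M x -> M (F x))
    (FM_precompact : precompact (F @` M))
    (F_envelope : forall x : X,
      (M `&` closed_convex_envelope_image M F) x ->
      [set x] `&` closed_convex_envelope M F x `<=` [set F x]) :
  exists x : X, M x /\ F x = x.
Proof.
have [x Mx Fx] := envelope_fixed_point R X M F
  M_nonempty M_closed M_convex F_maps FM_precompact.
exists x; split=> //; apply/esym/(F_envelope x); last by [].
by split=> //; exists x.
Qed.
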